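(* (a) For the complete graph $K_n$, $N_{sp}(K_n)=n$. (b) For the complete bipartite graph $K_{n,m}$ with $\min\{n,m\}\geq 2$, $N_{sp}(K_{n,m})=nm$. (c) For the star graph $K_{1,n}$, $N_{sp}(K_{1,n})=n+1$.
   Context: All graphs are finite, simple, undirected. For $S\subseteq V(G)$, $\overline{S}=V(G)\setminus S$ and $N(v)$ denotes the open neighbourhood of $v$. A set $S$ is a super dominating set of $G$ if every vertex of $\overline{S}$ has a neighbour in $S$ and for every $u\in\overline{S}$ there is $v\in S$ with $N(v)\cap\overline{S}=\{u\}$. The super domination number $\gamma_{sp}(G)$ is the minimum cardinality of a super dominating set of $G$. $N_{sp}(G)$ denotes the number of super dominating sets of $G$ of cardinality $\gamma_{sp}(G)$. In (a), $n\geq 2$ is implicit for $K_n$ to be considered; $K_{1,n}$ is the star with $n$ leaves. *)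

(* Defs.v *)
From mathcomp Require Import all_boot.

Set Implicit Arguments.
Unset Strict Implicit.
Unset Printing Implicit Defensive.

Record sgraph := SGraph {
  vertex :> finType;
  adj : rel vertex;
  adj_sym : symmetric adj;
  adj_irrefl : irreflexive adj
}.

Section SuperDomination.
Variable G : sgraph.

Definition open_nbhd (v : G) : {set G} := [set w | adj v w].

Definition dominating (S : {set G}) : bool :=
  [forall u in ~: S, [exists v in S, v \in open_nbhd u]].

Definition super_dominating (S : {set G}) : bool :=
  dominating S &&
  [forall u in ~: S, [exists v in S, open_nbhd v :&: ~: S == [set u]]].

(* The whole vertex set is always super dominating, so the default value of
   the argmin below is an admissible set. *)
Lemma super_dominatingT : super_dominating [set: G].
Proof.
by apply/andP; split; apply/forall_inP => u; rewrite setCT inE.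
Qed.

Definition super_domination_number : nat :=
  #|[arg min_(S < [set: G] | super_dominating S) #|S|]|.

Lemma super_domination_numberP :
  (exists2 S, super_dominating S & #|S| = super_domination_number) /\
  (forall S, super_dominating S -> super_domination_number <= #|S|).
Proof.
rewrite /super_domination_number.
case: arg_minnP => [|S sdS minS]; first exact: super_dominatingT.
by split; first exists S.
Qed.

Definition num_min_super_dominating : nat :=
  #|[set S : {set G} |
      super_dominating S && (#|S| == super_domination_number)]|.

End SuperDomination.

Section Complete.
Variable n : nat.

Definition complete_adj : rel 'I_n := fun x y => x != y.

Lemma complete_adj_sym : symmetric complete_adj.
Proof. by move=> x y; rewrite /complete_adj eq_sym. Qed.

Lemma complete_adj_irrefl : irreflexive complete_adj.
Proof. by move=> x; rewrite /complete_adj eqxx. Qed.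

Definition complete_graph : sgraph :=
  SGraph complete_adj_sym complete_adj_irrefl.

End Complete.

Section CompleteBipartite.
Variables n m : nat.

Definition bipartite_adj : rel ('I_n + 'I_m)%type := fun x y =>
  match x, y with
  | inl _, inr _ | inr _, inl _ => true
  | _, _ => false
  end.

Lemma bipartite_adj_sym : symmetric bipartite_adj.
Proof. by move=> [x|x] [y|y]. Qed.

Lemma bipartite_adj_irrefl : irreflexive bipartite_adj.
Proof. by move=> [x|x]. Qed.

Definition complete_bipartite_graph : sgraph :=
  SGraph bipartite_adj_sym bipartite_adj_irrefl.

End CompleteBipartite.

Definition star_graph (n : nat) : sgraph := complete_bipartite_graph 1 n.

(* Main.v *)
(** For [S] with complement [C], the private-neighbour condition already implies
    domination, so super domination only says that every [u] in [C] has a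
    neighbour outside [C] whose only neighbour in [C] is [u].  Minimum sets
    correspond to largest such [C]: in a complete graph or a star, [C] has at
    most one element, and any single non-isolated vertex works; in [K_{n,m}],
    vertices on one side share their neighbourhood, so [C] has at most one
    vertex on each side, and any choice of one on each works when both sides
    have at least two vertices. *)
Require Import Defs.
From mathcomp Require Import all_boot.

Set Implicit Arguments.
Unset Strict Implicit.
Unset Printing Implicit Defensive.

Lemma super_dominatingCP (G : sgraph) (C : {set G}) :
  reflect (forall u, u \in C ->
             exists2 v, v \notin C & forall w, adj v w && (w \in C) = (w == u))
          (super_dominating (~: C)).
Proof.
apply: (iffP andP) => [[_ /forall_inP sdC] u uC | sdC].
  have uS : u \in ~: ~: C by rewrite setCK.
  have /exists_inP[v] := sdC u uS.
  rewrite inE => vC /eqP nbv; exists v => // w.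
  by move/setP/(_ w): nbv; rewrite setCK !inE.
split; apply/forall_inP => u; rewrite setCK => /sdC[v vC nbv];
  apply/exists_inP; exists v; rewrite ?inE //.
  (* Domination: the private condition at [w = u] makes [v] itself a neighbour of [u]. *)
  by have := nbv u; rewrite eqxx (adj_sym u) => /andP[].
by apply/eqP/setP => w; rewrite !inE nbv.
Qed.

(** Complementation is a bijection on vertex sets that turns minimum sets into maximum complements.
    The bound and its attainment together pin down the super domination number as [#|G| - k], kept
    in additive form in [gammaE]. *)
Lemma num_min_super_dominatingE (G : sgraph) (k : nat) :
  (forall C : {set G}, super_dominating (~: C) -> #|C| <= k) ->
  (exists2 C : {set G}, super_dominating (~: C) & #|C| = k) ->
  num_min_super_dominating G =
  #|[set C : {set G} | super_dominating (~: C) && (#|C| == k)]|.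
Proof.
move=> maxk [C0 sdC0 cardC0].
have [[S sdS cardS] minS] := super_domination_numberP G.
have gammaE : k + super_domination_number G = #|G|.
  apply/eqP; rewrite eqn_leq; apply/andP; split.
    by rewrite -cardC0 -(cardsC C0) leq_add2l minS.
  by rewrite -cardS -(cardsC S) addnC leq_add2r maxk ?setCK.
rewrite /num_min_super_dominating -(card_preimset _ (@setC_inj G)).
apply: eq_card => C; rewrite !inE; congr (_ && _).
by rewrite -(eqn_add2l k) gammaE -(cardsC C) eqn_add2r.
Qed.

(** Any neighbour of [u] is private for [u] with respect to [[set u]], so the maximum complements
    are exactly the singletons. Serves complete graphs and stars with at least one leaf. *)
Lemma num_min_super_dominating_card (G : sgraph) :
  0 < #|G| -> (forall u : G, exists v, adj u v) ->
  (forall C : {set G}, super_dominating (~: C) -> #|C| <= 1) ->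
  num_min_super_dominating G = #|G|.
Proof.
move=> /card_gt0P[u0 _] nonisolated max1.
have sd1 (u : G) : super_dominating (~: [set u]).
  apply/super_dominatingCP => _ /set1P ->.
  have [v uv] := nonisolated u; exists v => [|w].
    by rewrite inE; apply: contraTneq uv => ->; rewrite adj_irrefl.
  by rewrite inE andbC; case: eqP => // ->; rewrite adj_sym uv.
rewrite (num_min_super_dominatingE max1); last by exists [set u0]; rewrite ?cards1.
rewrite -(card_imset predT (@set1_inj G)); apply: eq_card => C; rewrite inE.
apply/andP/imsetP => [[_ /cards1P[u ->]] | [u _ ->]]; first by exists u.
by rewrite sd1 cards1.
Qed.

Lemma num_min_super_dominating_complete (n : nat) :
  1 < n -> num_min_super_dominating (complete_graph n) = n.
Proof.
case: n => [|[|n]] // _; rewrite -[RHS]card_ord.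
apply: num_min_super_dominating_card => [|u|C /super_dominatingCP sdC].
- by rewrite card_ord.
- case: (eqVneq u ord0) => [->|u0]; first by exists ord_max.
  by exists ord0.
apply/card_le1_eqP => x y /sdC[v vC nbv] yC.
(* The private neighbour [v] of [x] lies outside [C], so it differs from [y] and is adjacent to
   it. *)
suff: y == x by move/eqP.
by rewrite -nbv yC andbT; apply: contraNneq vC => ->.
Qed.

Section Bipartite.
Variables n m : nat.
Local Notation K := (complete_bipartite_graph n m).
Implicit Type C : {set K}.

Definition on_left (u : K) : bool := if u is inl _ then true else false.

Lemma bipartite_adjE (u v : K) : adj u v = (on_left u != on_left v).
Proof. by case: u v => [?|?] [?|?]. Qed.

Lemma super_dominatingC_inj C :
  super_dominating (~: C) -> {in C &, injective on_left}.
Proof.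
move=> /super_dominatingCP sdC u w /sdC[v _ nbv] wC eq_uw.
apply/esym/eqP; rewrite -nbv wC andbT bipartite_adjE -eq_uw -bipartite_adjE.
by have := nbv u; rewrite eqxx => /andP[].
Qed.

Lemma super_dominatingC_le2 C : super_dominating (~: C) -> #|C| <= 2.
Proof.
move=> /super_dominatingC_inj injC.
by rewrite -(card_in_imset injC) -card_bool max_card.
Qed.

Lemma super_dominatingC_pair (x : 'I_n) (y : 'I_m) :
  1 < n -> 1 < m -> super_dominating (~: [set (inl x : K); inr y]).
Proof.
move=> n_gt1 m_gt1.
have other k (i : 'I_k) : 1 < k -> exists j, j != i.
  move=> k_gt1; apply/existsP; rewrite -[[exists _, _]]negbK negb_exists.
  apply: contraL k_gt1 => /forallP eqi; rewrite -leqNgt -[k]card_ord.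
  apply/card_le1_eqP => j j' _ _.
  by rewrite (eqP (negbNE (eqi j))) (eqP (negbNE (eqi j'))).
(* Private neighbours must avoid the pair: [inr y'] serves [inl x], and [inl x'] serves [inr y]. *)
have [x' nx] := other _ x n_gt1; have [y' ny] := other _ y m_gt1.
apply/super_dominatingCP => u; rewrite !inE => /orP[] /eqP ->.
  by exists (inr y') => [|[w|w]]; rewrite !inE ?orbF //=.
by exists (inl x') => [|[w|w]]; rewrite !inE ?orbF //=.
Qed.

Lemma card2_super_dominatingC C :
  super_dominating (~: C) -> #|C| = 2 ->
  exists x y, C = [set inl x; inr y].
Proof.
move=> /super_dominatingC_inj injC cardC.
(* An injective map from two elements to [bool] is onto, so [C] meets both sides. *)
have sideT : on_left @: C = setT.
  by apply/eqP; rewrite eqEcard subsetT cardsT card_bool card_in_imset ?cardC.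
have: true \in on_left @: C by rewrite sideT.
have: false \in on_left @: C by rewrite sideT.
case/imsetP=> -[//|y] yC _ /imsetP[[x|//] xC _].
exists x, y; apply/esym/eqP; rewrite eqEcard cardC cards2 /= andbT.
by apply/subsetP => u; rewrite !inE => /orP[] /eqP ->.
Qed.

Lemma num_min_super_dominating_bipartite :
  1 < n -> 1 < m -> num_min_super_dominating K = n * m.
Proof.
move=> n_gt1 m_gt1.
pose pair (p : 'I_n * 'I_m) : {set K} := [set inl p.1; inr p.2].
have sd_pair p : super_dominating (~: pair p) by apply: super_dominatingC_pair.
have card_pair p : #|pair p| = 2 by rewrite cards2.
have pair_inj : injective pair.
  move=> [x y] [x' y'] /setP eqp.
  have := eqp (inl x); have := eqp (inr y).
  by rewrite !inE /= !eqxx !orbF => /esym/eqP[->] /esym/eqP[->].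
rewrite (num_min_super_dominatingE super_dominatingC_le2); last first.
  by exists (pair (Ordinal (ltnW n_gt1), Ordinal (ltnW m_gt1))).
rewrite -[n in RHS]card_ord -[m in RHS]card_ord -card_prod.
rewrite -(card_imset predT pair_inj); apply: eq_card => C; rewrite inE.
apply/andP/imsetP => [[sdC /eqP cardC] | [p _ ->]]; last first.
  by rewrite sd_pair card_pair.
by have [x [y ->]] := card2_super_dominatingC sdC cardC; exists (x, y).
Qed.

End Bipartite.

Lemma num_min_super_dominating_star (n : nat) :
  num_min_super_dominating (star_graph n) = n.+1.
Proof.
case: n => [|n].
  (* Without leaves the star is one isolated vertex: no private neighbour exists, and the empty
     complement is the only one, giving the count 1. *)
  have max0 (C : {set star_graph 0}) : super_dominating (~: C) -> #|C| <= 0.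
    move=> /super_dominatingCP sdC; rewrite leqn0 cards_eq0.
    apply/set0Pn => -[u /sdC[v _ /(_ u)]].
    by case: u v => [u|[]//] [v|[]//]; rewrite eqxx.
  have sd0 : super_dominating (~: (set0 : {set star_graph 0})).
    by apply/super_dominatingCP => u; rewrite inE.
  rewrite (num_min_super_dominatingE max0); last by exists set0; rewrite ?cards0.
  rewrite -(cards1 (set0 : {set star_graph 0})); apply: eq_card => C.
  by rewrite !inE cards_eq0 andbC; case: eqP => // ->.
have cardG : #|star_graph n.+1| = n.+2 by rewrite card_sum !card_ord.
rewrite -cardG; apply: num_min_super_dominating_card => [|u|C sdC].
- by rewrite cardG.
- by case: u => u; [exists (inr ord0) | exists (inl ord0)].
(* A complement of size two would contain the centre, which is the only possible private neighbour
   of the leaf [inr y]. *)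
rewrite -ltnS ltn_neqAle super_dominatingC_le2 // andbT; apply/eqP => cardC.
have [x [y defC]] := card2_super_dominatingC sdC cardC.
have /super_dominatingCP/(_ (inr y)) := sdC.
rewrite defC !inE eqxx orbT => /(_ isT)[[v|v] vC nbv].
  by rewrite (ord1 v) (ord1 x) !inE eqxx in vC.
by have := nbv (inr y); rewrite eqxx.
Qed.

Theorem theorem6p1 :
  (forall n : nat, 2 <= n ->
     num_min_super_dominating (complete_graph n) = n) /\
  (forall n m : nat, 2 <= minn n m ->
     num_min_super_dominating (complete_bipartite_graph n m) = n * m) /\
  (forall n : nat,
     num_min_super_dominating (star_graph n) = n.+1).
Proof.
split; first exact: num_min_super_dominating_complete.
split; last exact: num_min_super_dominating_star.
move=> n m; rewrite leq_min => /andP[].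
exact: num_min_super_dominating_bipartite.
Qed.
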